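(* Let $\mathbb A$ be a two-dimensional non-degenerate evolution algebra over an algebraically closed field $\mathbb F$ of characteristic zero. Then $\mathbb A$ is isomorphic to only one of the following algebras (given by structure matrices in a natural basis $\{e_1,e_2\}$): (1) If $\delta(\mathbb A)=(1,1)$: (a) if $\Delta(\mathbb A)=(\mathbf O_1,\mathbf O_1)$, then $\mathbb A$ is isomorphic to $\mathbf A_{2,1}:\begin{pmatrix}0&1\\1&0\end{pmatrix}$; (b) if $\Delta(\mathbb A)=(\mathbf O_1,\mathbf E_1)$, then $\mathbb A$ is isomorphic to $\mathbf A_{2,2}^{\alpha}:\begin{pmatrix}0&\alpha\\1&1\end{pmatrix}$ for some $\alpha\in\mathbb F^*$; (c) if $\Delta(\mathbb A)=(\mathbf E_1,\mathbf E_1)$, then $\mathbb A$ is isomorphic to $\mathbf A_{2,3}^{\alpha,\beta}:\begin{pmatrix}1&\alpha\\\beta&1\end{pmatrix}$ for some $(\alpha,\beta)\in\mathbb F^2$ with $\alpha\beta\ne1$. The only isomorphisms are between algebras in the same family, and they are permutations of the basis elements; precisely, the only isomorphisms are $\mathbf A_{2,3}^{\alpha,\beta}\cong\mathbf A_{2,3}^{\beta,\alpha}$. (2) If $\delta(\mathbb A)=(2)$, then $\mathbb A$ is isomorphic either to $\mathbf E_2$ or to $\mathbf I_2$.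
   Context: Algebras are finite-dimensional over $\mathbb F$ with a bilinear product, not necessarily associative. An evolution algebra is an algebra having a basis $\mathbf B=\{e_1,\dots,e_n\}$ (a natural basis) with $e_ie_j=0$ for $i\ne j$; its structure matrix relative to $\mathbf B$ is $(w_{ki})$ where $e_i^2=\sum_k w_{ki}e_k$ (column $i$ gives $e_i^2$). An evolution algebra is written by giving its structure matrix. It is non-degenerate if $\mathrm{Ann}(\mathbb A)=\{x: x\mathbb A+\mathbb Ax=0\}$ is zero. An extending evolution subspace is a linear subspace spanned by a subset of some natural basis of $\mathbb A$. For subspaces $X,Y$, $XY$ denotes the linear span of all products, and $X^2=XX$. Every non-degenerate evolution algebra has a unique (up to order) decomposition $\mathbb A=\mathbb E_1\oplus\dots\oplus\mathbb E_r$, where the $\mathbb E_i$ are extending evolution subspaces with $\dim(\mathbb E_i^2)=1$, and $\mathbb E_i\mathbb E_j=0$, $\dim(\mathbb E_i^2+\mathbb E_j^2)=2$ for $i\neq j$. The $\delta$-index is $\delta(\mathbb A)=(\dim\mathbb E_1,\dots,\dim\mathbb E_r)$, arranged in non-increasing order. Let $\mathbb A_i$ be the algebra on $\mathbb E_i$ with product $x\cdot y=\pi_{\mathbb E_i}(xy)$, where $\pi_{\mathbb E_i}$ is the projection of $\mathbb A$ onto $\mathbb E_i$ along the other summands. With $m=\dim\mathbb E_i$, it is isomorphic to exactly one of the following (basis $e_1,\dots,e_m$, $e_ie_j=0$ for $i\ne j$): $\mathbf O_m$ (zero product); $\mathbf E_m$: $e_1^2=\dots=e_m^2=e_1$; or,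 for $m\ge2$, $\mathbf I_m$: $e_1^2=\dots=e_m^2=e_1+\mathbf ie_2$, where $\mathbf i^2=-1$. The $\Delta$-trace $\Delta(\mathbb A)$ is the sequence of these isomorphism types, ordered by non-increasing dimension and, in equal dimension, with $\mathbf O$ first, then $\mathbf E$, then $\mathbf I$.
   Formalization: The claim that the only isomorphisms are A_{2,3}^{α,β}≅A_{2,3}^{β,α} is false: e_1↦−e_1 gives A_{2,2}^α≅A_{2,2}^{−α}. The formal statement adds exactly this isomorphism to the list, for distinct algebras of the list. *)

(* Defs.v *)
From HB Require Import structures.
From mathcomp Require Import all_boot all_order all_algebra.

Set Implicit Arguments.
Unset Strict Implicit.
Unset Printing Implicit Defensive.

Import GRing.Theory.
Local Open Scope ring_scope.

(* [falgType] requires associativity and a unit, so finite-dimensional        *)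
(* algebras in the wide sense are bundled here.                               *)
Record nalg (F : fieldType) := NAlg {
  carrier :> vectType F;
  amul : {bilinear carrier -> carrier -> carrier}
}.

Declare Scope nalg_scope.
Delimit Scope nalg_scope with NA.
Notation "x ** y" := (amul _ x y) (at level 40, left associativity) : nalg_scope.
Local Open Scope nalg_scope.

Definition is_isom (F : fieldType) (A B : nalg F) (f : 'Hom(A, B)) : Prop :=
  bijective f /\ forall x y : A, f (x ** y) = f x ** f y.

Definition isomorphic (F : fieldType) (A B : nalg F) : Prop :=
  exists f : 'Hom(A, B), is_isom f.

(* The span of all products; bases suffice by bilinearity, see [nprodvP].     *)
Definition nprodv (F : fieldType) (A : nalg F) (U V : {vspace A}) : {vspace A} :=
  <<[seq x ** y | x <- vbasis U, y <- vbasis V]>>%VS.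

Lemma nprodvP (F : fieldType) (A : nalg F) (U V W : {vspace A}) :
  reflect {in U & V, forall u v, u ** v \in W} (nprodv U V <= W)%VS.
Proof.
apply: (iffP idP) => [sUVW u v Uu Vv | sUVW]; last first.
  apply/span_subvP=> _ /allpairsP[[u v] /= [Uu Vv ->]].
  by rewrite sUVW ?vbasis_mem.
rewrite (coord_vbasis Uu) (coord_vbasis Vv) linear_sumlz /=.
apply: memv_suml => i _; rewrite linearZl_LR memvZ // linear_sumr /=.
apply: memv_suml => j _; rewrite linearZr_LR memvZ //.
apply: (subvP sUVW); apply: memv_span; apply/allpairsP.
by exists ((vbasis U)`_i, (vbasis V)`_j); rewrite /= !mem_nth ?size_tuple.
Qed.

Definition natural_basis (F : fieldType) (A : nalg F) (e : seq A) : Prop :=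
  basis_of fullv e /\ {in e &, forall x y, x != y -> x ** y = 0}.

Definition evolution (F : fieldType) (A : nalg F) : Prop :=
  exists e : seq A, natural_basis e.

Definition nondegenerate_alg (F : fieldType) (A : nalg F) : Prop :=
  forall x : A,
    (nprodv <[x]> fullv + nprodv fullv <[x]> = 0)%VS -> x = 0.

Definition extending (F : fieldType) (A : nalg F) (X : {vspace A}) : Prop :=
  exists2 e : seq A, natural_basis e &
  exists2 s : seq A, {subset s <= e} & X = <<s>>%VS.

Definition decomposition (F : fieldType) (A : nalg F) (r : nat)
    (E : 'I_r -> {vspace A}) : Prop :=
  [/\ directv (\sum_i E i) /\ (\sum_i E i = fullv)%VS,
      forall i, extending (E i) /\ \dim (nprodv (E i) (E i)) = 1%N
    & forall i j, i != j ->
        nprodv (E i) (E j) = 0%VS /\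
        \dim (nprodv (E i) (E i) + nprodv (E j) (E j)) = 2%N].

(* As the decomposition is unique up to order, sequences attached to it are   *)
(* introduced as relations: the order of the E_i is the one making the        *)
(* sequence sorted.                                                           *)
Definition delta_index (F : fieldType) (A : nalg F) (d : seq nat) : Prop :=
  sorted geq d /\
  exists2 E : 'I_(size d) -> {vspace A},
    decomposition E & forall i, \dim (E i) = nth 0%N d i.

Definition summand_mul (F : fieldType) (A : nalg F) (r : nat)
    (E : 'I_r -> {vspace A}) (i : 'I_r) (x y : subvs_of (E i)) :
    subvs_of (E i) :=
  vsproj (E i) (daddv_pi (E i) (\sum_(j | j != i) E j)%VS (vsval x ** vsval y)).

Lemma summand_mul_bilinear (F : fieldType) (A : nalg F) (r : nat)
    (E : 'I_r -> {vspace A}) (i : 'I_r) :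
  bilinear_for *:%R *:%R (@summand_mul F A r E i).
Proof.
split=> [y a x x' | x a y y']; rewrite /summand_mul linearP.
  by rewrite linearPl !linearP.
by rewrite !linearP.
Qed.

HB.instance Definition _ (F : fieldType) (A : nalg F) (r : nat)
    (E : 'I_r -> {vspace A}) (i : 'I_r) :=
  bilinear_isBilinear.Build F _ _ _ *:%R *:%R (@summand_mul F A r E i)
    (@summand_mul_bilinear F A r E i).

Definition summand_alg (F : fieldType) (A : nalg F) (r : nat)
    (E : 'I_r -> {vspace A}) (i : 'I_r) : nalg F :=
  NAlg (@summand_mul F A r E i : {bilinear _ -> _ -> _}).

(* The evolution algebra with structure matrix W: column i of W lists the     *)
(* coordinates of e_i ^ 2.                                                    *)
Definition evo_mul (F : fieldType) (n : nat) (W : 'M[F]_n) (x y : 'cV[F]_n) :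
    'cV[F]_n :=
  \col_k \sum_i W k i * (x i 0 * y i 0).

Lemma evo_mul_bilinear (F : fieldType) (n : nat) (W : 'M[F]_n) :
  bilinear_for *:%R *:%R (evo_mul W).
Proof.
split=> [y a x x' | x a y y']; apply/matrixP => k l; rewrite !mxE mulr_sumr;
  rewrite -big_split; apply: eq_bigr => i _ /=; rewrite !mxE.
  by rewrite mulrDl mulrDr -mulrA mulrCA.
by rewrite mulrDr mulrDr (mulrCA (x i 0)) (mulrCA (W k i)).
Qed.

HB.instance Definition _ (F : fieldType) (n : nat) (W : 'M[F]_n) :=
  bilinear_isBilinear.Build F _ _ _ *:%R *:%R (evo_mul W) (evo_mul_bilinear W).

Definition evo (F : fieldType) (n : nat) (W : 'M[F]_n) : nalg F :=
  NAlg (evo_mul W : {bilinear _ -> _ -> _}).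

Definition evo_basis (F : fieldType) (n : nat) (W : 'M[F]_n) (i : 'I_n) : evo W :=
  delta_mx i 0 : 'cV[F]_n.

Lemma evo_basis_mul (F : fieldType) (n : nat) (W : 'M[F]_n) (i j : 'I_n) :
  evo_basis W i ** evo_basis W j =
    if i == j then \sum_k W k i *: evo_basis W k else 0.
Proof.
apply/matrixP => k l; rewrite ord1 /= !mxE (bigD1 i) //= big1 => [|h hi].
  rewrite !mxE !eqxx mul1r addr0 andbT.
  case: eqP => _; last by rewrite mulr0 mxE.
  rewrite mulr1 summxE (bigD1 k) //= big1 => [|h hk].
    by rewrite !mxE !eqxx mulr1 addr0.
  by rewrite !mxE [k == h]eq_sym (negPf hk) mulr0.
by rewrite !mxE (negPf hi) mul0r mulr0.
Qed.

Inductive kind := KO | KE | KI.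

Definition rank_kind (k : kind) : nat :=
  match k with KO => 0 | KE => 1 | KI => 2 end.

(* Structure matrices of O_m, E_m and I_m; [im] stands for a square root of   *)
(* -1.                                                                        *)
Definition kind_mx (F : fieldType) (im : F) (k : kind) (m : nat) : 'M[F]_m :=
  \matrix_(i, j) match k with
    | KO => 0
    | KE => if i == 0%N :> nat then 1 else 0
    | KI => if i == 0%N :> nat then 1 else if i == 1%N :> nat then im else 0
    end.

(* (k, m) encodes O_m, E_m or I_m; the last one only exists for m >= 2.       *)
Definition valid_type (t : kind * nat) : bool :=
  match t.1 with KI => (1 < t.2)%N | _ => (0 < t.2)%N end.

Definition le_type (t u : kind * nat) : bool :=
  ((u.2 < t.2) || ((t.2 == u.2) && (rank_kind t.1 <= rank_kind u.1)))%N.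

Definition Delta_trace (F : fieldType) (im : F) (A : nalg F)
    (D : seq (kind * nat)) : Prop :=
  [/\ all valid_type D, sorted le_type D
    & exists2 E : 'I_(size D) -> {vspace A},
        decomposition E
      & forall i, let t := tnth (in_tuple D) i in
          t.2 = \dim (E i) /\
          isomorphic (summand_alg E i) (evo (kind_mx im t.1 t.2))].

Definition mx2 (F : fieldType) (a b c d : F) : 'M[F]_2 :=
  \matrix_(i, j) nth 0 (nth [::] [:: [:: a; b]; [:: c; d]] i) j.

Inductive model (F : fieldType) :=
  | A21
  | A22 of F
  | A23 of F & F
  | E2
  | I2.
Arguments A21 {F}.
Arguments E2 {F}.
Arguments I2 {F}.

Definition admissible (F : fieldType) (t : model F) : Prop :=
  match t with
  | A22 a => a != 0
  | A23 a b => a * b != 1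
  | _ => True
  end.

Definition model_mx (F : fieldType) (im : F) (t : model F) : 'M[F]_2 :=
  match t with
  | A21 => mx2 0 1
               1 0
  | A22 a => mx2 0 a
                 1 1
  | A23 a b => mx2 1 a
                   b 1
  | E2 => kind_mx im KE 2
  | I2 => kind_mx im KI 2
  end.

Definition model_alg (F : fieldType) (im : F) (t : model F) : nalg F :=
  evo (model_mx im t).

Definition model_basis (F : fieldType) (im : F) (t : model F) (i : 'I_2) :
    model_alg im t :=
  evo_basis (model_mx im t) i.

(* Main.v *)
(* A change of natural basis acts on the two structure columns by scalar
   equations. When the structure matrix W is invertible, natural bases are unique
   up to scaling and permutation, so the zero pattern of the diagonal of W is an
   invariant and rescaling normalizes the remaining entries. When W has rank one,
   both squares are nonzero by non-degeneracy and can be made equal to one vector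
   u; then u ^ 2 is zero (I_2) or not (E_2). *)
From HB Require Import structures.
Require Import Defs.
From mathcomp Require Import all_boot all_order all_algebra.
From mathcomp Require Import ring.

Import GRing.Theory.
Local Open Scope ring_scope.
Local Open Scope nalg_scope.

Set Implicit Arguments.
Unset Strict Implicit.
Unset Printing Implicit Defensive.

(** * Natural bases with prescribed structure constants *)

Definition has_structure (F : fieldType) (A : nalg F) (n : nat)
    (v : n.-tuple A) (W : 'M[F]_n) : Prop :=
  basis_of fullv v /\
  forall i j : 'I_n, v`_i ** v`_j = if i == j then \sum_k W k i *: v`_k else 0.

(** Taking coordinates in [v] is the isomorphism; in the expansion of a product over [v] only the
    diagonal terms survive. *)
Lemma has_structure_isomorphic (F : fieldType) (A : nalg F) (n : nat)
    (v : n.-tuple A) (W : 'M[F]_n) :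
  has_structure v W -> isomorphic A (evo W).
Proof.
move=> [vB vM].
pose f (x : A) : evo W := \col_k coord v k x.
have fL : linear f.
  by move=> a x y; apply/matrixP => k l; rewrite !mxE linearP.
pose fM := GRing.isLinear.Build _ _ _ _ f fL.
pose fl : {linear A -> evo W} := HB.pack f fM.
have fE x : linfun fl x = f x by rewrite lfunE.
exists (linfun fl); split.
  exists (fun y : evo W => \sum_k (y : 'cV_n) k 0 *: v`_k) => x; rewrite fE /f.
    rewrite [RHS](coord_basis vB (memvf x)).
    by apply: eq_bigr => k _; rewrite mxE.
  apply/matrixP => k l; rewrite mxE ord1 coord_sum_free //.
  exact: basis_free vB.
move=> x y; rewrite !fE; apply/matrixP => k l; rewrite !mxE.
rewrite {1}(coord_basis vB (memvf x)) {1}(coord_basis vB (memvf y)).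
rewrite linear_sumlz /= linear_sum; apply: eq_bigr => i _ /=.
rewrite linear_sumr linear_sum (bigD1 i) //= big1 => [|j ji].
  rewrite linearZl_LR linearZr_LR !linearZ /= vM eqxx.
  rewrite coord_sum_free; last exact: basis_free vB.
  by rewrite !mxE addr0; ring.
by rewrite linearZl_LR linearZr_LR /= vM eq_sym (negPf ji) !scaler0 linear0.
Qed.

(** The scalars run through the structure matrix by columns, so that matrix is [mx2 a c b d].
    Keeping them as separate variables reduces changes of basis to goals for [ring] and [field]. *)
Definition frame2 (F : fieldType) (A : nalg F) (v w : A) (a b c d : F) : Prop :=
  [/\ basis_of fullv [:: v; w], v ** w = 0, w ** v = 0,
      v ** v = a *: v + b *: w & w ** w = c *: v + d *: w].

Lemma frame2_free (F : fieldType) (A : nalg F) (v w : A) a b c d x y :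
  frame2 v w a b c d -> x *: v + y *: w = 0 -> x = 0 /\ y = 0.
Proof.
case=> /basis_free/(@freeP _ _ 2 [tuple _; _]) fr _ _ _ _ xy.
have := fr (fun i : 'I_2 => [:: x; y]`_i).
rewrite !big_ord_recl big_ord0 /= addr0 => /(_ xy) k.
by split; [exact: (k ord0) | exact: (k (lift ord0 ord0))].
Qed.

Lemma frame2_decompose (F : fieldType) (A : nalg F) (v w : A) a b c d (x : A) :
  frame2 v w a b c d -> exists p q, x = p *: v + q *: w.
Proof.
case=> vB _ _ _ _.
have := coord_basis (n := 2) (X := [tuple v; w]) vB (memvf x).
by rewrite !big_ord_recl big_ord0 /= addr0 => ->; do 2! eexists.
Qed.

Lemma frame2_isomorphic (F : fieldType) (A : nalg F) (v w : A) a b c d :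
  frame2 v w a b c d -> isomorphic A (evo (mx2 a c b d)).
Proof.
case=> vB vw wv vv ww; apply: (@has_structure_isomorphic _ _ _ [tuple v; w]).
split=> // i j; rewrite !big_ord_recl big_ord0 addr0 !mxE.
by case: i j => [[|[|//]] ?] [[|[|//]] ?]; rewrite /= ?vw ?wv ?vv ?ww.
Qed.

Lemma frame2_mul (F : fieldType) (A : nalg F) (v w : A) a b c d p q r s :
  frame2 v w a b c d ->
  (p *: v + q *: w) ** (r *: v + s *: w) =
    (p * r * a + q * s * c) *: v + (p * r * b + q * s * d) *: w.
Proof.
case=> _ vw wv vv ww.
rewrite linearDl /= !linearDr /= !linearZl_LR /= !linearZr_LR /= vw wv vv ww.
by rewrite !scaler0 addr0 add0r !scalerDr !scalerA !scalerDl addrACA.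
Qed.

(** The first two equations make the mixed products vanish; the other four compare coordinates of
    the two new squares. Independence of the new vectors is Cramer's rule. *)
Lemma frame2_change (F : fieldType) (A : nalg F) (v w : A) a b c d
    p q r s a' b' c' d' :
    frame2 v w a b c d -> p * s - q * r != 0 ->
    p * r * a + q * s * c = 0 -> p * r * b + q * s * d = 0 ->
    p * p * a + q * q * c = a' * p + b' * r ->
    p * p * b + q * q * d = a' * q + b' * s ->
    r * r * a + s * s * c = c' * p + d' * r ->
    r * r * b + s * s * d = c' * q + d' * s ->
  frame2 (p *: v + q *: w) (r *: v + s *: w) a' b' c' d'.
Proof.
move=> fr D0 e1 e2 e3 e4 e5 e6.
have E x y : x *: (p *: v + q *: w) + y *: (r *: v + s *: w) =
    (x * p + y * r) *: v + (x * q + y * s) *: w.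
  by rewrite !scalerDr !scalerDl !scalerA addrACA.
split; rewrite ?(frame2_mul _ _ _ _ fr) ?E ?e1 ?e2 ?e3 ?e4 ?e5 ?e6 //;
  try by rewrite ?[r * p]mulrC ?[s * q]mulrC ?e1 ?e2 !scale0r addr0.
rewrite basisEfree subvf /=; apply/andP; split; last first.
  by case: fr => /size_basis <-.
apply/(@freeP _ _ 2 [tuple _; _]) => k.
rewrite !big_ord_recl big_ord0 /= addr0 E => /(frame2_free fr) [h1 h2].
set x := k _ in h1 h2; set y := k _ in h1 h2.
have DK z : z * (p * s - q * r) = 0 -> z = 0.
  by move/eqP; rewrite mulf_eq0 (negPf D0) orbF => /eqP.
have x0 : x = 0.
  apply: DK.
  transitivity (s * (x * p + y * r) - r * (x * q + y * s)); first by ring.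
  by rewrite h1 h2 !mulr0 subr0.
have y0 : y = 0.
  apply: DK.
  transitivity (p * (x * q + y * s) - q * (x * p + y * r)); first by ring.
  by rewrite h1 h2 !mulr0 subr0.
case=> [[|[|//]] i]; [rewrite -x0 | rewrite -y0]; congr k; exact: val_inj.
Qed.

Lemma frame2_swap (F : fieldType) (A : nalg F) (v w : A) a b c d :
  frame2 v w a b c d -> frame2 w v d c b a.
Proof.
case=> vB vw wv vv ww; split=> //; rewrite 1?addrC //.
by rewrite (perm_basis _ (permEl (perm_catC [:: w] [:: v]))).
Qed.

(** If v ^ 2 = 0, then v kills both basis vectors on both sides, so it lies in the annihilator. *)
Lemma frame2_square_neq0 (F : fieldType) (A : nalg F) (v w : A) a b c d :
  nondegenerate_alg A -> frame2 v w a b c d -> (a != 0) || (b != 0).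
Proof.
move=> nd fr; rewrite -negb_and; apply/negP => /andP[/eqP a0 /eqP b0].
rewrite {}a0 {}b0 in fr.
have v0 : v = 0.
  apply: nd; apply/eqP; rewrite -subv0 subv_add.
  apply/andP; split; apply/nprodvP => x y; rewrite memv0.
    move=> /vlineP[k ->] _; have [p [q ->]] := frame2_decompose y fr.
    have := frame2_mul k 0 p q fr; rewrite scale0r addr0 => ->.
    by rewrite !mul0r !mulr0 addr0 !scale0r addr0.
  move=> _ /vlineP[k ->]; have [p [q ->]] := frame2_decompose x fr.
  have := frame2_mul p q k 0 fr; rewrite scale0r addr0 => ->.
  by rewrite !mulr0 !mul0r addr0 !scale0r addr0.
have [] := frame2_free (x := 1) (y := 0) fr.
  by rewrite v0 scaler0 scale0r addr0.
by move/eqP; rewrite oner_eq0.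
Qed.

(** * Normal forms *)

Lemma exists_root (F : closedFieldType) n (x : F) :
  (0 < n)%N -> exists y, y ^+ n = x.
Proof.
move=> n0; have [y yE] := solve_monicpoly (fun i => if i == 0 then x else 0) n0.
exists y; rewrite yE; case: n n0 {yE} => // n _.
rewrite big_ord_recl big1 => [|i _]; first by rewrite expr0 mulr1 addr0.
by rewrite mul0r.
Qed.

(** For v' = p v, the equation v' ^ 2 = w' forces w' = p ^ 2 b w; then w' ^ 2 = v' amounts to p ^ 3
    c b ^ 2 = 1. *)
Lemma frame2_A21 (F : closedFieldType) (im : F) (A : nalg F) (v w : A) b c :
  frame2 v w 0 b c 0 -> b != 0 -> c != 0 -> isomorphic A (model_alg im A21).
Proof.
move=> fr b0 c0; have [p p3] := @exists_root F 3 (c * b ^+ 2)^-1 isT.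
have p0 : p != 0.
  apply: contra_eq_neq p3 => ->.
  by rewrite expr0n eq_sym invr_eq0 mulf_neq0 // expf_neq0.
apply: frame2_isomorphic; apply: (frame2_change (p := p) (q := 0) (r := 0)
  (s := p ^+ 2 * b) fr); try by ring.
  by rewrite mulr0 subr0 !mulf_neq0 ?expf_neq0.
transitivity (p * (p ^+ 3 * (c * b ^+ 2))); first by ring.
rewrite p3; field; exact/andP.
Qed.

(** The diagonal entry 1 forces w' = w / d, and (p v) ^ 2 = w' then asks for p ^ 2 = 1 / (b d). The
    two choices of p give parameters of opposite sign. *)
Lemma frame2_A22 (F : closedFieldType) (im : F) (A : nalg F) (v w : A) b c d :
    frame2 v w 0 b c d -> b != 0 -> c != 0 -> d != 0 ->
  exists a, a != 0 /\ isomorphic A (model_alg im (A22 a)).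
Proof.
move=> fr b0 c0 d0; have [p p2] := @exists_root F 2 (b * d)^-1 isT.
have p0 : p != 0.
  by apply: contra_eq_neq p2 => ->; rewrite expr0n eq_sym invr_eq0 mulf_neq0.
exists (c / (p * d ^+ 2)); split.
  by rewrite mulf_neq0 // invr_eq0 mulf_neq0 // expf_neq0.
apply: frame2_isomorphic; apply: (frame2_change (p := p) (q := 0) (r := 0)
  (s := d^-1) fr); try by (ring || field; rewrite ?p0 ?d0).
  by rewrite mulr0 subr0 mulf_neq0 ?invr_eq0.
transitivity (p ^+ 2 * b); first by ring.
by rewrite p2; field; rewrite ?b0 ?d0.
Qed.

(** Dividing v by a and w by d makes both diagonal entries 1. The parameters then satisfy 1 - x y =
    (a d - b c) / (a d). *)
Lemma frame2_A23 (F : fieldType) (im : F) (A : nalg F) (v w : A) a b c d :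
    frame2 v w a b c d -> a != 0 -> d != 0 -> a * d - b * c != 0 ->
  exists x y, x * y != 1 /\ isomorphic A (model_alg im (A23 x y)).
Proof.
move=> fr a0 d0 D0; exists (c * a / d ^+ 2), (b * d / a ^+ 2); split.
  rewrite -subr_eq0 -oppr_eq0.
  have -> : - (c * a / d ^+ 2 * (b * d / a ^+ 2) - 1) =
            (a * d - b * c) / (a * d) by field; apply/andP.
  by rewrite mulf_neq0 // invr_eq0 mulf_neq0.
apply: frame2_isomorphic; apply: (frame2_change (p := a^-1) (q := 0) (r := 0)
  (s := d^-1) fr); try by (ring || field; rewrite ?a0 ?d0).
by rewrite mulr0 subr0 mulf_neq0 ?invr_eq0.
Qed.

Lemma kind_mxE2 (F : fieldType) (im : F) : kind_mx im KE 2 = mx2 1 1 0 0.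
Proof.
apply/matrixP => i j; rewrite !mxE.
by case: i j => [[|[|//]] ?] [[|[|//]] ?].
Qed.

Lemma kind_mxI2 (F : fieldType) (im : F) : kind_mx im KI 2 = mx2 1 1 im im.
Proof.
apply/matrixP => i j; rewrite !mxE.
by case: i j => [[|[|//]] ?] [[|[|//]] ?].
Qed.

(* The common square u = x v + y w satisfies u ^ 2 = (x ^ 2 + y ^ 2) u. If u is
   anisotropic, u / (x ^ 2 + y ^ 2) is idempotent and a rotation puts it in first
   position; if it is isotropic, y = +- im x. *)
Lemma frame2_equal_squares (F : fieldType) (im : F) (im2 : im ^+ 2 = -1)
    (A : nalg F) (v w : A) x y :
    frame2 v w x y x y -> (x != 0) || (y != 0) ->
  isomorphic A (model_alg im E2) \/ isomorphic A (model_alg im I2).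
Proof.
move=> fr u0; rewrite /model_alg /= kind_mxE2 kind_mxI2.
have [S0|S0] := eqVneq (x ^+ 2 + y ^+ 2) 0; [right | left].
  (* The sign [e] goes into the scaling of w, so that both cases reach the same root [im]. *)
  have [e e2 yE] : exists2 e : F, e ^+ 2 = 1 & y = e * im * x.
    have : (y - im * x) * (y + im * x) = 0.
      by rewrite -subr_sqr exprMn im2 mulN1r opprK addrC.
    move/eqP; rewrite mulf_eq0 subr_eq0 addr_eq0 => /orP[] /eqP ->.
      by exists 1; rewrite ?expr1n ?mul1r.
    by exists (-1); rewrite ?sqrrN ?expr1n ?mulNr ?mul1r.
  have x0 : x != 0 by apply: contraTneq u0 => x0; rewrite yE x0 mulr0 eqxx.
  have e0 : e != 0 by apply: contra_eq_neq e2 => ->; rewrite expr0n eq_sym oner_eq0.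
  apply: frame2_isomorphic; apply: (frame2_change (p := x^-1) (q := 0) (r := 0)
    (s := e / x) fr); rewrite ?yE; try by (ring || field; rewrite ?x0).
  - by rewrite mulr0 subr0 !mulf_neq0 // invr_eq0.
  - by transitivity (e ^+ 2 / x); [field | rewrite e2; field].
  - by transitivity (e ^+ 2 * (e * im) / x); [field | rewrite e2; field].
apply: frame2_isomorphic; apply: (frame2_change (p := x / (x ^+ 2 + y ^+ 2))
  (q := y / (x ^+ 2 + y ^+ 2)) (r := - y / (x ^+ 2 + y ^+ 2))
  (s := x / (x ^+ 2 + y ^+ 2)) fr); try by field.
have -> : x / (x ^+ 2 + y ^+ 2) * (x / (x ^+ 2 + y ^+ 2)) -
    y / (x ^+ 2 + y ^+ 2) * (- y / (x ^+ 2 + y ^+ 2)) = (x ^+ 2 + y ^+ 2)^-1.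
  by field.
by rewrite invr_eq0.
Qed.

(** The second square is k times the first, with k nonzero. Replacing w by t w with t ^ 2 = 1 / k
    makes the two squares equal to a v + b w, whose coordinate along t w is b / t. *)
Lemma frame2_rank1 (F : closedFieldType) (im : F) (im2 : im ^+ 2 = -1)
    (A : nalg F) (v w : A) a b c d :
    frame2 v w a b c d -> (a != 0) || (b != 0) -> (c != 0) || (d != 0) ->
    a * d - b * c = 0 ->
  isomorphic A (model_alg im E2) \/ isomorphic A (model_alg im I2).
Proof.
move=> fr u0 w0 D0.
have [k cE dE] : exists2 k, c = k * a & d = k * b.
  have ad : a * d = b * c by apply/eqP; rewrite -subr_eq0 D0.
  case/orP: u0 => [a0|b0]; [exists (c / a) | exists (d / b)].
  - by rewrite divfK.
  - by rewrite mulrAC [c * b]mulrC -ad [a * d]mulrC mulfK.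
  - by rewrite mulrAC [d * a]mulrC ad [b * c]mulrC mulfK.
  - by rewrite divfK.
have k0 : k != 0.
  by apply: contraTneq w0 => k0; rewrite cE dE k0 !mul0r eqxx.
have [t t2] := @exists_root F 2 k^-1 isT.
have t0 : t != 0.
  by apply: contra_eq_neq t2 => ->; rewrite expr0n eq_sym invr_eq0.
apply: (frame2_equal_squares im2 (v := 1 *: v + 0 *: w) (w := 0 *: v + t *: w)
  (x := a) (y := b / t)); last by rewrite mulf_eq0 invr_eq0 (negPf t0) orbF.
apply: (frame2_change fr); rewrite ?cE ?dE; try by (ring || field).
- by rewrite mul1r mul0r subr0.
- transitivity (t ^+ 2 * k * a); first by ring.
  by rewrite t2; field; rewrite ?k0 ?t0.
- by transitivity (t ^+ 2 * k * b); [field | rewrite t2; field; rewrite ?k0 ?t0].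
Qed.

Lemma frame2_model (F : closedFieldType) (im : F) (im2 : im ^+ 2 = -1)
    (A : nalg F) (v w : A) a b c d :
    nondegenerate_alg A -> frame2 v w a b c d ->
  exists t : model F, admissible t /\ isomorphic A (model_alg im t).
Proof.
move=> nd fr.
have u0 := frame2_square_neq0 nd fr.
have w0 := frame2_square_neq0 nd (frame2_swap fr); rewrite orbC in w0.
have [D0|D0] := eqVneq (a * d - b * c) 0.
  by have [] := frame2_rank1 im2 fr u0 w0 D0; [exists E2 | exists I2].
have [a0|a0] := eqVneq a 0; have [d0|d0] := eqVneq d 0.
- rewrite {}a0 {}d0 in fr u0 w0 D0; move: u0 w0.
  rewrite eqxx /= orbF => b0 c0.
  by exists A21; split=> //; apply: frame2_A21 fr b0 c0.
- rewrite {}a0 in fr u0 D0; rewrite eqxx /= in u0.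
  have c0 : c != 0.
    by apply: contraNneq D0 => ->; rewrite mul0r mulr0 subr0.
  have [x [x0 xA]] := frame2_A22 im fr u0 c0 d0.
  by exists (A22 x).
(* When only the second diagonal entry vanishes, exchanging v and w gives the shape of [A22]. *)
- rewrite {}d0 in fr w0 D0; rewrite eqxx orbF in w0.
  have b0 : b != 0.
    by apply: contraNneq D0 => ->; rewrite mul0r mulr0 subr0.
  have [x [x0 xA]] := frame2_A22 im (frame2_swap fr) w0 b0 a0.
  by exists (A22 x).
- have [x [y [xy0 xyA]]] := frame2_A23 im fr a0 d0 D0.
  by exists (A23 x y).
Qed.

(** * The square of the algebra and the index (2) *)

Lemma frame2_of_basis (F : fieldType) (A : nalg F) (v w : A) :
    basis_of fullv [:: v; w] -> v ** w = 0 -> w ** v = 0 ->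
  exists a b c d, frame2 v w a b c d.
Proof.
move=> vB vw wv.
have dec x := coord_basis (X := [tuple v; w]) vB (memvf (x : A)).
have := dec (v ** v); have := dec (w ** w).
rewrite !big_ord_recl !big_ord0 /= !addr0 => ww vv.
by do 4! eexists; split=> //; [exact: vv | exact: ww].
Qed.

Lemma evolution_frame2 (F : fieldType) (A : nalg F) :
    \dim (fullv : {vspace A}) = 2%N -> evolution A ->
  exists v w a b c d, @frame2 F A v w a b c d.
Proof.
move=> d2 [e [eB eM]]; have := size_basis (X := in_tuple e) eB; rewrite d2.
case: e eB eM => [|v [|w [|? ?]]] //= eB eM _.
have vw : v != w by have := free_uniq (basis_free eB); rewrite /= inE andbT.
have [a [b [c [d fr]]]] : exists a b c d, frame2 v w a b c d.
  by apply: frame2_of_basis => //; apply: eM; rewrite ?inE ?eqxx ?orbT // eq_sym.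
by exists v, w, a, b, c, d.
Qed.

Lemma frame2_free_squares (F : fieldType) (A : nalg F) (v w : A) a b c d :
  frame2 v w a b c d -> free [:: v ** v; w ** w] = (a * d - b * c != 0).
Proof.
move=> fr; have [_ _ _ vv ww] := fr.
have E x y : x *: (v ** v) + y *: (w ** w) =
    (x * a + y * c) *: v + (x * b + y * d) *: w.
  by rewrite vv ww !scalerDr !scalerA addrACA -!scalerDl.
apply/(@freeP _ _ 2 [tuple _; _])/idP => [fvw | D0 k].
  apply/eqP => D0.
  have fvw2 x y : x *: (v ** v) + y *: (w ** w) = 0 -> x = 0 /\ y = 0.
    move=> xy; have := fvw (fun i : 'I_2 => [:: x; y]`_i).
    rewrite !big_ord_recl big_ord0 /= addr0 => /(_ xy) k.
    by split; [exact: (k ord0) | exact: (k (lift ord0 ord0))].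
  (* With zero determinant, (d, -b) and (c, -a) are coefficients of linear relations between the
     squares. Freeness makes all four scalars vanish, hence both squares, which contradicts
     freeness. *)
  have [] := fvw2 d (- b).
    rewrite E; have -> : d * a + - b * c = 0 by rewrite -D0; ring.
    by rewrite mulNr [d * b]mulrC subrr !scale0r addr0.
  move=> d0 /eqP; rewrite oppr_eq0 => /eqP b0.
  have [] := fvw2 c (- a).
    rewrite E; have -> : c * b + - a * d = 0 by rewrite -oppr0 -D0; ring.
    by rewrite mulNr [c * a]mulrC subrr !scale0r addr0.
  move=> c0 /eqP; rewrite oppr_eq0 => /eqP a0.
  have [] := fvw2 1 0; last by move/eqP; rewrite oner_eq0.
  by rewrite E a0 b0 c0 d0 !mulr0 addr0 !scale0r addr0.
rewrite !big_ord_recl big_ord0 /= addr0 E => /(frame2_free fr) [h1 h2].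
set x := k _ in h1 h2; set y := k _ in h1 h2.
have DK z : z * (a * d - b * c) = 0 -> z = 0.
  by move/eqP; rewrite mulf_eq0 (negPf D0) orbF => /eqP.
have x0 : x = 0.
  apply: DK; transitivity (d * (x * a + y * c) - c * (x * b + y * d)).
    by ring.
  by rewrite h1 h2 !mulr0 subr0.
have y0 : y = 0.
  apply: DK; transitivity (a * (x * b + y * d) - b * (x * a + y * c)).
    by ring.
  by rewrite h1 h2 !mulr0 subr0.
by case=> [[|[|//]] i]; [rewrite -x0 | rewrite -y0]; congr k; exact: val_inj.
Qed.

Lemma frame2_dim_square1 (F : fieldType) (A : nalg F) (v w : A) a b c d :
    frame2 v w a b c d -> (\dim (nprodv (fullv : {vspace A}) fullv) <= 1)%N ->
  a * d - b * c = 0.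
Proof.
move=> fr dA; apply/eqP; apply: contraTT dA.
rewrite -(frame2_free_squares fr) -ltnNge => fvw.
have memA (x y : A) : x ** y \in nprodv (fullv : {vspace A}) fullv.
  have/nprodvP mm := subvv (nprodv (fullv : {vspace A}) fullv).
  by apply: mm; rewrite memvf.
rewrite (_ : 2 = \dim <<[:: v ** v; w ** w]>>)%N; last by rewrite (eqP fvw).
by apply: dimvS; apply/span_subvP => z; rewrite !inE => /orP[] /eqP ->.
Qed.

(** The single summand is the whole algebra, so its square having dimension 1 puts the structure
    matrix in rank one. *)
Lemma delta2_model (F : closedFieldType) (im : F) (im2 : im ^+ 2 = -1)
    (A : nalg F) :
    \dim (fullv : {vspace A}) = 2%N -> evolution A -> nondegenerate_alg A ->
    delta_index A [:: 2%N] ->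
  isomorphic A (model_alg im E2) \/ isomorphic A (model_alg im I2).
Proof.
move=> d2 evA nd [_ [E [_ Esq _] Edim]].
have Efull : E ord0 = fullv.
  by apply/eqP; rewrite eqEdim subvf /= Edim d2.
have [_ dE] := Esq ord0; rewrite Efull in dE.
have [v [w [a [b [c [d fr]]]]]] := evolution_frame2 d2 evA.
apply: (frame2_rank1 im2 fr).
- exact: frame2_square_neq0 nd fr.
- by rewrite orbC; exact: frame2_square_neq0 nd (frame2_swap fr).
- by apply: frame2_dim_square1 fr _; rewrite dE.
Qed.

(** * Decompositions into two lines *)

Lemma dim1_vline (F : fieldType) (V : vectType F) (U : {vspace V}) :
  \dim U = 1%N -> exists2 v, v != 0 & U = <[v]>%VS.
Proof.
move=> U1; have v0 : vpick U != 0 by rewrite vpick0 -dimv_eq0 U1.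
exists (vpick U) => //; apply/esym/eqP.
by rewrite eqEdim -memvE memv_pick dim_vline v0 U1.
Qed.

Lemma nprodv_vline (F : fieldType) (A : nalg F) (v : A) :
  (nprodv <[v]> <[v]> <= <[v ** v]>)%VS.
Proof.
apply/nprodvP => _ _ /vlineP[p ->] /vlineP[q ->].
by rewrite linearZl_LR linearZr_LR !memvZ ?memv_line.
Qed.

(** Generators of the two lines form the frame. The condition that the squares of the summands span
    dimension 2 makes v ^ 2 and w ^ 2 independent, hence the nonzero determinant. *)
Lemma decomposition_frame2 (F : fieldType) (A : nalg F)
    (E : 'I_2 -> {vspace A}) :
    \dim (fullv : {vspace A}) = 2%N -> decomposition E ->
    (forall i, \dim (E i) = 1%N) ->
  exists v w a b c d, [/\ frame2 v w a b c d, a * d - b * c != 0,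
    E ord0 = <[v]>%VS & E (lift ord0 ord0) = <[w]>%VS].
Proof.
move=> d2 [[_ Efull] _ Eij] E1.
have [v v0 Ev] := dim1_vline (E1 ord0).
have [w w0 Ew] := dim1_vline (E1 (lift ord0 ord0)).
have [vw0 sq2] := Eij ord0 (lift ord0 ord0) isT.
have [wv0 _] := Eij (lift ord0 ord0) ord0 isT.
have mul0 (x y : A) (U V : {vspace A}) :
    nprodv U V = 0%VS -> x \in U -> y \in V -> x ** y = 0.
  move=> UV0 Ux Vy; apply/eqP; rewrite -memv0.
  by have/nprodvP/(_ x y Ux Vy) := subvv (nprodv U V); rewrite UV0.
have vw : v ** w = 0 by apply: mul0 vw0 _ _; rewrite ?Ev ?Ew memv_line.
have wv : w ** v = 0 by apply: mul0 wv0 _ _; rewrite ?Ev ?Ew memv_line.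
have vB : basis_of fullv [:: v; w].
  rewrite basisEdim d2 andbT -Efull !big_ord_recl big_ord0 addv0 Ev Ew.
  by rewrite span_cons span_seq1.
have [a [b [c [d fr]]]] := frame2_of_basis vB vw wv.
exists v, w, a, b, c, d; split=> //.
rewrite -(frame2_free_squares fr) /free eqn_leq dim_span /= -[X in (X <= _)%N]sq2.
rewrite dimvS // Ev Ew span_cons span_seq1.
exact: addvS (nprodv_vline _) (nprodv_vline _).
Qed.

Section SummandLine.

Variables (F : fieldType) (A : nalg F) (r : nat) (E : 'I_r -> {vspace A}).
Variables (i : 'I_r) (im x : F) (v y : A).
Hypotheses (dE : directv (\sum_j E j)) (v0 : v != 0) (Ev : E i = <[v]>%VS).
Hypotheses (vv : v ** v = x *: v + y) (Ey : y \in (\sum_(j | j != i) E j)%VS).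

(** The part [y] of v ^ 2 lies in the other summands and is lost in the projection, so the product
    on the line is given by v . v = x v. *)
Let vsval_square (s : summand_alg E i) p :
  vsval s = p *: v -> vsval (s ** s) = (p * p * x) *: v.
Proof.
move=> sE; rewrite vsprojK ?memv_pi // sE linearZl_LR linearZr_LR vv.
have cap0 : (E i :&: \sum_(j | j != i) E j = 0)%VS.
  by have/directv_sumP/(_ i isT) := dE.
(* The two projections of [y] add up to [y], and the one onto the other summands is already [y]. *)
have piy : daddv_pi (E i) (\sum_(j | j != i) E j)%VS y = 0.
  have := daddv_pi_add (w := y) cap0 (subvP (addvSr _ _) _ Ey).
  rewrite (daddv_pi_id _ Ey) 1?capvC // => /eqP.
  by rewrite eq_sym -subr_eq subrr eq_sym => /eqP.
rewrite !linearZ linearD /= piy addr0 linearZ /= daddv_pi_id //.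
  by rewrite !scalerA.
by rewrite Ev memvZ ?memv_line.
Qed.

Lemma summand_line_KO :
  isomorphic (summand_alg E i) (evo (kind_mx im KO 1)) -> x = 0.
Proof.
case=> f [fB fM]; pose s : summand_alg E i := vsproj (E i) v.
have sE : vsval s = 1 *: v by rewrite scale1r vsprojK // Ev memv_line.
have ss0 : s ** s = 0.
  apply: (bij_inj fB); rewrite fM linear0; apply/matrixP => k l.
  by rewrite !mxE big1 // => j _; rewrite mxE mul0r.
have := vsval_square sE; rewrite ss0 linear0 !mul1r => /esym/eqP.
by rewrite scaler_eq0 (negPf v0) orbF => /eqP.
Qed.

(** The nonzero idempotent of E_1 pulls back to a nonzero idempotent on the line, whereas x = 0
    would make every square there vanish. *)
Lemma summand_line_KE :
  isomorphic (summand_alg E i) (evo (kind_mx im KE 1)) -> x != 0.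
Proof.
case=> f [fB fM]; have [g _ gK] := fB.
pose e := evo_basis (kind_mx im KE 1) ord0.
have ee : e ** e = e.
  by rewrite evo_basis_mul eqxx big_ord1 mxE scale1r.
have ss : g e ** g e = g e by apply: (bij_inj fB); rewrite fM !gK.
have /vlineP[p sE] : vsval (g e) \in <[v]>%VS by rewrite -Ev subvsP.
apply/eqP => x0; have := vsval_square sE; rewrite ss x0 mulr0 scale0r => s0.
have : e = 0 by rewrite -[e]gK (_ : g e = 0) ?linear0 //; apply: val_inj.
by move/matrixP/(_ ord0 ord0)/eqP; rewrite !mxE eqxx oner_eq0.
Qed.

End SummandLine.

(** The type of each line is read off the diagonal of the structure matrix: the off-diagonal terms b
    w and c v belong to the other line. *)
Lemma Delta_trace11_frame2 (F : fieldType) (im : F) (A : nalg F) (k l : kind) :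
    \dim (fullv : {vspace A}) = 2%N ->
    Delta_trace im A [:: (k, 1%N); (l, 1%N)] ->
  exists v w a b c d, [/\ @frame2 F A v w a b c d, a * d - b * c != 0,
    (k = KO -> a = 0) /\ (k = KE -> a != 0) &
    (l = KO -> d = 0) /\ (l = KE -> d != 0)].
Proof.
move=> d2 [_ _ [E dec Eiso]].
have E1 i : \dim (E i) = 1%N.
  by have [<- _] := Eiso i; case: i => [[|[|//]] ?].
have [v [w [a [b [c [d [fr D0 Ev Ew]]]]]]] := decomposition_frame2 d2 dec E1.
have [[dE _] _ _] := dec; have [_ _ _ vv ww] := fr.
have v0 : v != 0.
  by apply: contra_eq_neq (E1 ord0) => v0; rewrite Ev v0 dim_vline eqxx.
have w0 : w != 0.
  apply: contra_eq_neq (E1 (lift ord0 ord0)) => w0.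
  by rewrite Ew w0 dim_vline eqxx.
have yv : b *: w \in (\sum_(j | j != ord0) E j)%VS.
  rewrite memvZ // (bigD1 (lift ord0 ord0)) //= (subvP (addvSl _ _)) //.
  by rewrite Ew memv_line.
have yw : c *: v \in (\sum_(j | j != lift ord0 ord0) E j)%VS.
  rewrite memvZ // (bigD1 ord0) //= (subvP (addvSl _ _)) //.
  by rewrite Ev memv_line.
have [_ iso0] := Eiso ord0; have [_ iso1] := Eiso (lift ord0 ord0).
rewrite addrC in ww.
exists v, w, a, b, c, d; split=> //; split=> kE; rewrite kE in iso0 iso1.
- exact: summand_line_KO dE v0 Ev vv yv iso0.
- exact: summand_line_KE dE Ev vv yv iso0.
- exact: summand_line_KO dE w0 Ew ww yw iso1.
- exact: summand_line_KE dE Ew ww yw iso1.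
Qed.

(** * Isomorphisms in coordinates *)

Lemma frame2_isom (F : fieldType) (A B : nalg F) (f : 'Hom(A, B))
    (v w : A) (v' w' : B) a b c d a' b' c' d' :
    is_isom f -> frame2 v w a b c d -> frame2 v' w' a' b' c' d' ->
  exists p q r s,
    [/\ f v = p *: v' + q *: w', f w = r *: v' + s *: w' & p * s - q * r != 0]
    /\ [/\ p * r * a' + q * s * c' = 0, p * r * b' + q * s * d' = 0,
      p * p * a' + q * q * c' = a * p + b * r /\
      p * p * b' + q * q * d' = a * q + b * s
    & r * r * a' + s * s * c' = c * p + d * r /\
      r * r * b' + s * s * d' = c * q + d * s].
Proof.
move=> [fB fM] fr fr'.
have [p [q fv]] := frame2_decompose (f v) fr'.
have [r [s fw]] := frame2_decompose (f w) fr'.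
have E x y : f (x *: v + y *: w) = (x * p + y * r) *: v' + (x * q + y * s) *: w'.
  rewrite linearD !linearZ /= fv fw !scalerDr !scalerA addrACA.
  by rewrite -!scalerDl.
have eqB x y z t : x *: v' + y *: w' = z *: v' + t *: w' -> x = z /\ y = t.
  move/eqP; rewrite -subr_eq0 opprD addrACA -!scalerBl => /eqP.
  by move/(frame2_free fr') => [/eqP + /eqP]; rewrite !subr_eq0 => /eqP + /eqP.
have [_ vw _ vv ww] := fr.
exists p, q, r, s; split.
  split=> //; apply/eqP => D0.
  have inj x y : x * p + y * r = 0 -> x * q + y * s = 0 -> x = 0 /\ y = 0.
    move=> h1 h2; apply: (frame2_free fr); apply: (bij_inj fB).
    by rewrite E h1 h2 linear0 !scale0r addr0.
  (* With zero determinant, (s, -q) and (r, -p) are coordinates of vectors killed by f. Injectivity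
     makes all four entries vanish, so f v = 0, which is absurd. *)
  have [||s0 /eqP] := inj s (- q).
  - by rewrite -D0; ring.
  - by ring.
  rewrite oppr_eq0 => /eqP q0.
  have [||r0 /eqP] := inj r (- p).
  - by ring.
  - by rewrite -oppr0 -D0; ring.
  rewrite oppr_eq0 => /eqP p0; have [||] := inj 1 0; rewrite ?p0 ?q0 ?r0 ?s0 ?mulr0 ?addr0 //.
  by move/eqP; rewrite oner_eq0.
have eqs := frame2_mul _ _ _ _ fr'.
split.
- by have := fM v w; rewrite vw linear0 fv fw eqs => /esym/(frame2_free fr')[].
- by have := fM v w; rewrite vw linear0 fv fw eqs => /esym/(frame2_free fr')[].
- by have := fM v v; rewrite vv E fv eqs => /eqB[-> ->].
- by have := fM w w; rewrite ww E fw eqs => /eqB[-> ->].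
Qed.

(** * Isomorphisms between the models *)

Lemma model_frame2 (F : fieldType) (im : F) (t : model F) :
  frame2 (model_basis im t 0) (model_basis im t 1)
    (model_mx im t 0 0) (model_mx im t 1 0)
    (model_mx im t 0 1) (model_mx im t 1 1).
Proof.
have sq i : model_basis im t i ** model_basis im t i =
    model_mx im t 0 i *: model_basis im t 0 +
    model_mx im t 1 i *: model_basis im t 1.
  rewrite /model_basis evo_basis_mul eqxx !big_ord_recl big_ord0 addr0.
  by rewrite (_ : lift ord0 ord0 = 1) //; apply: val_inj.
split; rewrite ?sq // /model_basis ?evo_basis_mul //.
rewrite basisEfree subvf dimvf /dim /= andbT.
apply/(@freeP _ _ 2 [tuple _; _]) => k.
rewrite !big_ord_recl big_ord0 /= addr0 => /matrixP kE i.
have := kE i 0; rewrite !mxE.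
case: i => [[|[|//]] i]; rewrite /= ?mulr1 ?mulr0 ?addr0 ?add0r => <-;
  by congr k; apply: val_inj.
Qed.

(* With M = [p r; q s] the matrix of f, the hypotheses say that W' maps the
   entrywise squares of the columns of M to M W and their entrywise product to
   0. Taking determinants, W and W' have the same rank; if W' is invertible, the
   entrywise product is 0, so that M is monomial. *)
Lemma frame2_isom_monomial (F : fieldType) (A B : nalg F) (f : 'Hom(A, B))
    (v w : A) (v' w' : B) a b c d a' b' c' d' :
    is_isom f -> frame2 v w a b c d -> frame2 v' w' a' b' c' d' ->
    (a * d - b * c != 0) || (a' * d' - b' * c' != 0) ->
  [/\ a * d - b * c != 0, a' * d' - b' * c' != 0 &
    (exists p s, [/\ p != 0, s != 0, f v = p *: v' /\ f w = s *: w',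
      p * a' = a /\ s * d' = d & p ^+ 2 * b' = b * s /\ s ^+ 2 * c' = c * p]) \/
    (exists q r, [/\ q != 0, r != 0, f v = q *: w' /\ f w = r *: v',
      q * d' = a /\ r * a' = d & q ^+ 2 * c' = b * r /\ r ^+ 2 * b' = c * q])].
Proof.
move=> fI fr fr' rk2.
have [p [q [r [s [[fv fw M0] [e1 e2 [e3 e4] [e5 e6]]]]]]] := frame2_isom fI fr fr'.
(* The entrywise square of M has determinant (p s) ^ 2 - (q r) ^ 2, a multiple of det M, which then
   cancels. *)
have detE : (a' * d' - b' * c') * (p * s + q * r) * (p * s - q * r) =
    (a * d - b * c) * (p * s - q * r).
  transitivity ((a * p + b * r) * (c * q + d * s) -
                (a * q + b * s) * (c * p + d * r)); last by ring.
  by rewrite -e3 -e4 -e5 -e6; ring.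
move/(mulIf M0) in detE.
have D0 : a' * d' - b' * c' != 0.
  by case/orP: rk2 => //; rewrite -detE mulf_eq0 negb_or => /andP[].
have DK z : z * (a' * d' - b' * c') = 0 -> z = 0.
  by move/eqP; rewrite mulf_eq0 (negPf D0) orbF => /eqP.
have pr0 : p * r = 0.
  apply: DK; transitivity
    (d' * (p * r * a' + q * s * c') - c' * (p * r * b' + q * s * d')).
    by ring.
  by rewrite e1 e2 !mulr0 subr0.
have qs0 : q * s = 0.
  apply: DK; transitivity
    (a' * (p * r * b' + q * s * d') - b' * (p * r * a' + q * s * c')).
    by ring.
  by rewrite e1 e2 !mulr0 subr0.
(* Since p r = 0, one of p s and q r vanishes, so p s + q r is det M up to sign. *)
rewrite -detE mulf_neq0 //; last first.
  move/eqP: pr0; rewrite mulf_eq0 => /orP[] /eqP z0; move: M0.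
    by rewrite z0 !mul0r sub0r add0r oppr_eq0.
  by rewrite z0 !mulr0 subr0 addr0.
split=> //; have [p0|p0] := eqVneq p 0; [right | left].
  rewrite p0 mul0r sub0r oppr_eq0 mulf_eq0 negb_or in M0.
  case/andP: M0 => q0 r0.
  have s0 : s = 0 by move/eqP: qs0; rewrite mulf_eq0 (negPf q0) => /eqP.
  rewrite p0 s0 !(mul0r, mulr0, add0r, addr0, scale0r) in fv fw e3 e4 e5 e6.
  exists q, r; rewrite !expr2; split=> //; split=> //.
    by apply: (mulfI q0); rewrite mulrA e4 mulrC.
  by apply: (mulfI r0); rewrite mulrA e5 mulrC.
have r0 : r = 0 by move/eqP: pr0; rewrite mulf_eq0 (negPf p0) => /eqP.
rewrite r0 mulr0 subr0 mulf_eq0 negb_or in M0; case/andP: M0 => _ s0.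
have q0 : q = 0 by move/eqP: qs0; rewrite mulf_eq0 (negPf s0) orbF => /eqP.
rewrite q0 r0 !(mul0r, mulr0, add0r, addr0, scale0r) in fv fw e3 e4 e5 e6.
exists p, s; rewrite !expr2; split=> //; split=> //.
  by apply: (mulfI p0); rewrite mulrA e3 mulrC.
by apply: (mulfI s0); rewrite mulrA e6 mulrC.
Qed.

(** In E_2 the vector e_1 is idempotent, while I_2 has no nonzero idempotent: its squares are
    multiples of n = e_1 + i e_2, and n ^ 2 = 0. *)
Lemma E2_not_isomorphic_I2 (F : fieldType) (im : F) (im2 : im ^+ 2 = -1) :
  ~ isomorphic (model_alg im E2) (model_alg im I2).
Proof.
case=> f fI; have := frame2_isom fI (model_frame2 im E2) (model_frame2 im I2).
rewrite !mxE /= => -[p [q [r [s [[_ _ M0] [_ _ [e1 e2] _]]]]]].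
have pE : p * p + q * q = p.
  by rewrite -[RHS]addr0; move: e1; rewrite !(mulr1, mul1r, mul0r).
have qE : q = im * p.
  rewrite -[LHS]addr0 -pE mulrDr mulrC; move: e2.
  by rewrite !(mulr1, mul1r, mul0r) ![im * _]mulrC.
have p0 : p = 0.
  rewrite -pE qE; transitivity ((1 + im ^+ 2) * p ^+ 2); first by ring.
  by rewrite im2 subrr mul0r.
by move: M0; rewrite qE p0 mulr0 !mul0r subrr eqxx.
Qed.

(** The vector n = e_1 + i e_2 of I_2 is a square with n ^ 2 = 0. Squares of E_2 are multiples of
    e_1, so f n = z e_1 with z = p + im r; then z ^ 2 = 0 and f kills n. *)
Lemma I2_not_isomorphic_E2 (F : fieldType) (im : F) (im2 : im ^+ 2 = -1) :
  ~ isomorphic (model_alg im I2) (model_alg im E2).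
Proof.
case=> f fI; have := frame2_isom fI (model_frame2 im I2) (model_frame2 im E2).
rewrite !mxE /= => -[p [q [r [s [[_ _ M0] [e0 _ [e1 e2] [e3 _]]]]]]].
rewrite !(mulr1, mul1r, mulr0, mul0r, addr0) in e0 e1 e2 e3.
have qE : q = - (im * s) by apply/eqP; rewrite -addr_eq0 -e2.
have z0 : p + im * r = 0.
  apply/eqP; rewrite -sqrf_eq0; apply/eqP.
  (* This is (f n) ^ 2 expanded as f(e_1) ^ 2 - f(e_2) ^ 2 + 2 i f(e_1) f(e_2), with a multiple of 1
     + im ^ 2 as correction. *)
  transitivity ((p * p + q * q) - (r * r + s * s) +
    (im + im) * (p * r + q * s) + (1 + im ^+ 2) * (r ^+ 2 + s ^+ 2)).
    by rewrite qE; ring.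
  by rewrite e0 e1 e3 im2 !subrr mulr0 mul0r !addr0.
move: M0; rewrite qE.
have -> : p = - (im * r) by apply/eqP; rewrite -addr_eq0 z0.
by rewrite !mulNr opprK mulrAC addNr eqxx.
Qed.

Lemma model_det_neq0 (F : fieldType) (im : F) (t : model F) :
    admissible t ->
  (model_mx im t 0 0 * model_mx im t 1 1 -
     model_mx im t 1 0 * model_mx im t 0 1 != 0) =
    match t with E2 | I2 => false | _ => true end.
Proof.
case: t => [|a|a b||] /= ta; rewrite !mxE /= ?(mulr0, mul0r, mul1r, mulr1);
  rewrite ?sub0r ?oppr_eq0 ?oner_eq0 ?subrr ?eqxx //.
by rewrite subr_eq0 eq_sym mulrC.
Qed.

Lemma model_isom (F : fieldType) (im : F) (im2 : im ^+ 2 = -1)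
    (t u : model F) (f : 'Hom(model_alg im t, model_alg im u)) :
    admissible t -> admissible u -> t <> u -> is_isom f ->
  (exists a b : F,
     [/\ t = A23 a b, u = A23 b a,
         f (model_basis im t 0) = model_basis im u 1
       & f (model_basis im t 1) = model_basis im u 0]) \/
  (exists a : F,
     [/\ t = A22 a, u = A22 (- a),
         f (model_basis im t 0) = - model_basis im u 0
       & f (model_basis im t 1) = model_basis im u 1]).
Proof.
move=> ta ua tu fI.
have dt := model_det_neq0 im ta; have du := model_det_neq0 im ua.
have [rk|] := boolP ((model_mx im t 0 0 * model_mx im t 1 1 -
    model_mx im t 1 0 * model_mx im t 0 1 != 0) ||
  (model_mx im u 0 0 * model_mx im u 1 1 -
    model_mx im u 1 0 * model_mx im u 0 1 != 0)); last first.
  (* Both matrices are singular here, which leaves only E_2 against I_2. *)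
  rewrite dt du {dt du}; case: t u f ta ua tu fI => [|?|? ?||] [|?|? ?||] //.
    by move=> f _ _ _ fI; case: (E2_not_isomorphic_I2 im2); exists f.
  by move=> f _ _ _ fI; case: (I2_not_isomorphic_E2 im2); exists f.
have := frame2_isom_monomial fI (model_frame2 im t) (model_frame2 im u) rk.
rewrite dt du {rk dt du}.
case: t u f ta ua tu fI => [|a|a b||] [|a'|a' b'||] f //= ta ua tu _ [] // _ _;
  rewrite !mxE /= => -[[p [s [p0 s0 [fv fw] [e1 e2] [e3 e4]]]] |
                       [q [r [q0 r0 [fv fw] [e1 e2] [e3 e4]]]]];
  rewrite ?(mulr0, mul0r, mulr1, mul1r) in e1 e2 e3 e4;
  (* A monomial map matches zero diagonal entries with zero ones; any other pairing forces a scaling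
     factor, or 1, to be 0. *)
  try (by [ rewrite e1 eqxx in p0 | rewrite e2 eqxx in s0
          | rewrite e1 eqxx in q0 | rewrite e2 eqxx in r0
          | move/eqP: e1; rewrite eq_sym oner_eq0
          | move/eqP: e2; rewrite eq_sym oner_eq0 ]).
(* Between two [A22] the second vector is fixed and p ^ 2 = 1. As p = 1 would give t = u, the first
   vector changes sign, and so does the parameter. *)
- right; exists a; rewrite e2 scale1r in e3 fw.
  have /eqP : (p - 1) * (p + 1) = 0 by rewrite -subr_sqr e3 expr1n subrr.
  rewrite mulf_eq0 subr_eq0 addr_eq0 => /orP[] /eqP pE.
    by case: tu; rewrite -[a]mulr1 -pE -e4 e2 expr1n mul1r.
  split=> //; last by rewrite fv pE scaleN1r.
  by rewrite -[- a]mulrN1 -pE -e4 e2 expr1n mul1r.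
(* Between two [A23] the unit diagonals force both factors to be 1: the diagonal map gives t = u,
   and the exchange of the vectors swaps the parameters. *)
- case: tu; rewrite e1 e2 !expr1n !(mul1r, mulr1) in e3 e4.
  by rewrite e3 e4.
- left; exists a, b; rewrite e1 e2 !expr1n !(mul1r, mulr1) ?scale1r in fv fw e3 e4.
  by rewrite fv fw e3 e4.
Qed.

Theorem theorem28 (F : closedFieldType) (charF0 : [pchar F] =i pred0)
    (im : F) (im2 : im ^+ 2 = -1) :
  [/\ (forall A : nalg F,
        \dim (fullv : {vspace A}) = 2%N -> evolution A -> nondegenerate_alg A ->
        [/\ (exists t : model F,
              admissible t /\ isomorphic A (model_alg im t)),
            (delta_index A [:: 1%N; 1%N] ->
              [/\ (Delta_trace im A [:: (KO, 1%N); (KO, 1%N)] ->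
                    isomorphic A (model_alg im A21)),
                  (Delta_trace im A [:: (KO, 1%N); (KE, 1%N)] ->
                    exists a : F,
                      a != 0 /\ isomorphic A (model_alg im (A22 a)))
                & (Delta_trace im A [:: (KE, 1%N); (KE, 1%N)] ->
                    exists a b : F,
                      a * b != 1 /\ isomorphic A (model_alg im (A23 a b)))])
          & (delta_index A [:: 2%N] ->
              isomorphic A (model_alg im E2) \/
              isomorphic A (model_alg im I2))]),
      (forall t u : model F, admissible t -> admissible u -> t <> u ->
        forall f : 'Hom(model_alg im t, model_alg im u), is_isom f ->
          (exists a b : F,
            [/\ t = A23 a b, u = A23 b a,
                f (model_basis im t 0) = model_basis im u 1
              & f (model_basis im t 1) = model_basis im u 0])
          \/
          (exists a : F,
            [/\ t = A22 a, u = A22 (- a),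
                f (model_basis im t 0) = - model_basis im u 0
              & f (model_basis im t 1) = model_basis im u 1])),
      (forall a b : F, a * b != 1 ->
        isomorphic (model_alg im (A23 a b)) (model_alg im (A23 b a)))
    & (forall a : F, a != 0 ->
        isomorphic (model_alg im (A22 a)) (model_alg im (A22 (- a))))].
Proof.
split=> [A d2 evA nd | t u ta ua tu f | a b _ | a _].
- split; last exact: delta2_model.
    have [v [w [a [b [c [d fr]]]]]] := evolution_frame2 d2 evA.
    exact: frame2_model fr.
  move=> _; split=> /(Delta_trace11_frame2 d2) => -[v [w [a [b [c [d [fr D0]]]]]]].
  + move=> [/(_ erefl) a0 _] [/(_ erefl) d0 _]; subst.
    move: D0; rewrite mul0r sub0r oppr_eq0 mulf_eq0 negb_or => /andP[b0 c0].
    exact: frame2_A21 fr b0 c0.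
  + move=> [/(_ erefl) a0 _] [_ /(_ erefl) d0]; subst.
    move: D0; rewrite mul0r sub0r oppr_eq0 mulf_eq0 negb_or => /andP[b0 c0].
    exact: frame2_A22 fr b0 c0 d0.
  + move=> [_ /(_ erefl) a0] [_ /(_ erefl) d0].
    exact: frame2_A23 fr a0 d0 D0.
- exact: model_isom.
- have := model_frame2 im (A23 a b); rewrite !mxE /=.
  by move/frame2_swap/frame2_isomorphic.
(* Replacing e_1 by -e_1 keeps e_1 ^ 2 and flips the coefficient of e_1 in e_2 ^ 2. *)
- have := model_frame2 im (A22 a); rewrite !mxE /= => fr.
  apply: frame2_isomorphic; apply: (frame2_change (p := -1) (q := 0) (r := 0)
    (s := 1) fr); try by ring.
  by rewrite mulr1 mulr0 subr0 oppr_eq0 oner_eq0.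
Qed.
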